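(* Let $a\in C^1((0,\infty))$ be a positive function such that $a\in L^1(1,\infty)$, set $$A(r)=-\int_r^\infty a(s)\,ds,\qquad r\in(0,\infty),$$ and assume that there is a concave function $B:(0,\infty)\to\mathbb{R}$ such that $$0\le -r\,A(r)\le B(r)\quad\text{for all } r\in(0,\infty),\qquad \lim_{r\to\infty}\frac{B(r)}{r}=0.$$ Then, for any $M>0$, there is at least one initial condition $u_0\in C([0,1])$ satisfying $u_0\ge m_0>0$ and $\langle u_0\rangle=M$ for some $m_0\in(0,M)$ for which the first component $u$ of the corresponding maximal classical solution $(u,v)$ to the quasilinear Smoluchowski-Poisson system with diffusion coefficient $a$ blows up in finite time, i.e. its maximal existence time satisfies $T_{max}<\infty$.
   Context: For an integrable function $g$ on a bounded interval $I$, $\langle g\rangle:=\frac{1}{|I|}\int_I g(x)\,dx$. Given a positive $a\in C^1((0,\infty))$ with indefinite integral $A$ (i.e. $A'=a$) and $u_0\in C([0,1])$ with $M=\langle u_0\rangle$, the one-dimensional quasilinear Smoluchowski-Poisson system on $(0,T)\times(0,1)$ is $$\partial_t u=\partial_x\big(a(u)\,\partial_x u-u\,\partial_x v\big),\qquad 0=\partial_x^2 v+u-M\quad\text{in }(0,T)\times(0,1),$$ $$\partial_x A(u)(t,0)=\partial_x A(u)(t,1)=\partial_x v(t,0)=\partial_x v(t,1)=0\quad\text{for } t\in(0,T),$$ $$u(0)=u_0\ \text{ in }(0,1),\qquad \langle v(t)\rangle=0\ \text{ for } t\in(0,T).$$ When $u_0\ge m_0>0$ with $m_0\in(0,M)$,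 the corresponding maximal classical solution is the unique pair $(u,v)\in C([0,T_{max})\times[0,1];\mathbb{R}^2)\cap C^{1,2}((0,T_{max})\times[0,1];\mathbb{R}^2)$ solving the system on $[0,T_{max})$, with $\langle u(t)\rangle=M$ and $u(t,x)\ge \frac{Mm_0}{m_0+e^{Mt}(M-m_0)}>0$ for all $(t,x)\in[0,T_{max})\times[0,1]$, where $T_{max}\in(0,\infty]$ is the maximal existence time: if $T_{max}<\infty$, then $\|u(t)\|_{L^\infty(0,1)}\to\infty$ as $t\to T_{max}$. Here $C^{1,2}$ means continuously differentiable once in time $t$ and twice in space $x$. *)

(* Defs.v *)
From HB Require Import structures.
From mathcomp Require Import all_boot all_order all_algebra.
From mathcomp Require Import all_classical all_reals all_analysis.

Set Implicit Arguments.
Unset Strict Implicit.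
Unset Printing Implicit Defensive.

Import Order.TTheory GRing.Theory Num.Theory.
Import numFieldNormedType.Exports.

Local Open Scope classical_set_scope.
Local Open Scope ring_scope.

Section defs.
Context {R : realType}.
Local Notation mu := (@lebesgue_measure R).

Definition mean (I : set R) (g : R -> R) : R :=
  (fine (mu I))^-1 * \int[mu]_(x in I) g x.

Definition linfty_norm01 (f : R -> R) : \bar R :=
  'N[mrestr mu (measurable_itv `]0%R, 1%R[)]_+oo%E[EFin \o f]%E.

(* [x^'] is the deleted neighbourhood filter of [x]: relative to [D = `[0, 1]]
   these are the one-sided derivatives at the endpoints and the usual ones at
   the interior points. *)
Definition derivable_within (D : set R) (f : R -> R) (x : R) : Prop :=
  cvg ((f y - f x) / (y - x) @[y --> within D x^']).

Definition derive_within (D : set R) (f : R -> R) (x : R) : R :=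
  lim ((f y - f x) / (y - x) @[y --> within D x^']).

(* Functions of [(t, x)] with [x] in [[0, 1]] are curried total functions;
   their values outside the domain are irrelevant. *)
Definition dt (w : R -> R -> R) : R -> R -> R :=
  fun t x => derive1 (fun s => w s x) t.

Definition dx (w : R -> R -> R) : R -> R -> R :=
  fun t x => derive_within `[0, 1] (w t) x.

Definition continuous_in (J : set R) (w : R -> R -> R) : Prop :=
  {within J `*` `[0, 1], continuous (fun p : R * R => w p.1 p.2)}.

Definition C12 (J : set R) (w : R -> R -> R) : Prop :=
  [/\ forall t x, J t -> x \in `[0, 1] ->
        [/\ derivable (fun s => w s x) t 1,
            derivable_within `[0, 1] (w t) x
          & derivable_within `[0, 1] (dx w t) x],
      continuous_in J w,
      continuous_in J (dt w),
      continuous_in J (dx w)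
    & continuous_in J (dx (dx w))].

Definition C1_pos (a : R -> R) : Prop :=
  {in `]0, +oo[, forall r, derivable a r 1} /\
  {in `]0, +oo[, continuous (derive1 a)}.

Definition time_co (T : \bar R) : set R := [set t | 0 <= t /\ (t%:E < T)%E].

Definition time_oo (T : \bar R) : set R := [set t | 0 < t /\ (t%:E < T)%E].

(* [cs_u_lower] makes [u] positive when [0 < m0 < M], so [a] and [A] are only
   evaluated on ]0, +oo[. [M] stands for the mean of [u0]. The condition
   [cs_init] is on the open interval; with [cs_continuous_u] it extends to
   [[0, 1]]. *)
Record classical_solution (a A : R -> R) (M m0 : R) (u0 : R -> R)
    (T : \bar R) (u v : R -> R -> R) : Prop := ClassicalSolution {
  cs_continuous_u : continuous_in (time_co T) u ;
  cs_continuous_v : continuous_in (time_co T) v ;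
  cs_C12_u : C12 (time_oo T) u ;
  cs_C12_v : C12 (time_oo T) v ;
  cs_u_eq : forall t x, time_oo T t -> x \in `]0, 1[ ->
    dt u t x =
    dx (fun s y => a (u s y) * dx u s y - u s y * dx v s y) t x ;
  cs_v_eq : forall t x, time_oo T t -> x \in `]0, 1[ ->
    0 = dx (dx v) t x + u t x - M ;
  cs_u_bc : forall t, time_oo T t ->
    dx (fun s y => A (u s y)) t 0 = 0 /\ dx (fun s y => A (u s y)) t 1 = 0 ;
  cs_v_bc : forall t, time_oo T t -> dx v t 0 = 0 /\ dx v t 1 = 0 ;
  cs_init : forall x, x \in `]0, 1[ -> u 0 x = u0 x ;
  cs_v_mean : forall t, time_oo T t -> mean `[0, 1] (v t) = 0 ;
  cs_u_mean : forall t, time_co T t -> mean `[0, 1] (u t) = M ;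
  cs_u_lower : forall t x, time_co T t -> x \in `[0, 1] ->
    M * m0 / (m0 + expR (M * t) * (M - m0)) <= u t x
}.

(* [Tmax] ranges over ]0, +oo]. [mcs_maximal] says that no classical solution
   with the same data lives longer; [mcs_blowup] is the continuation criterion
   in the sup norm. *)
Record maximal_classical_solution (a A : R -> R) (M m0 : R) (u0 : R -> R)
    (Tmax : \bar R) (u v : R -> R -> R) : Prop := MaximalClassicalSolution {
  mcs_pos : (0 < Tmax)%E ;
  mcs_solution : classical_solution a A M m0 u0 Tmax u v ;
  mcs_maximal : forall (T : \bar R) (u' v' : R -> R -> R),
    (0 < T)%E -> classical_solution a A M m0 u0 T u' v' -> (T <= Tmax)%E ;
  mcs_blowup : (Tmax < +oo)%E ->
    linfty_norm01 (u t) @[t --> (fine Tmax)^'-] --> +oo%E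
}.

End defs.

(* Main.v *)
Require Import Defs.
From HB Require Import structures.
From mathcomp Require Import all_boot all_order all_algebra.
From mathcomp Require Import all_classical all_reals all_analysis.
From mathcomp Require Import measurable_realfun ring lra.

Import Order.TTheory GRing.Theory Num.Theory.
Import numFieldNormedType.Exports.

Local Open Scope classical_set_scope.
Local Open Scope ring_scope.

(* The mass U(t,x) = int_0^x u(t,y) dy equals M x - v_x(t,x), increases in x from
   0 to M, and solves U_t = J := A(u)_x + u (U - M x). For L = int_0^1 U^3 dx an
   integration by parts gives
     L' / 3 = M^2 A(u(t,1)) - 2 int U u A(u) - M^4/12 + (M/3) L.
   The first term is nonpositive. Concavity and sublinearity give
   - r A(r) <= B(r) <= e r + C for every e > 0, whence
   - 2 int U u A(u) <= e M^2 + 2 C int U, and U <= d + U^3/d^2. With e and d small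
   this becomes L' <= K L - M^4/8, so a global solution, for which L >= 0 always,
   must satisfy L >= M^4/(8 K). This fails at small times when u0 has
   most of its mass close to x = 1, since L <= M^2 int U. *)

(** * Relative continuity of compositions, products and powers *)

Section within_topology.
Context {X Y : topologicalType} {R : realType}.
Implicit Types (A : set X) (B : set Y).

(** Since [f] maps [A] into [B], its values approach [f x] within [B], so [g] is only probed there.
    This allows composing with [a] and [A], which are controlled on the positive half-line only. *)
Lemma within_continuous_comp_sub {Z : topologicalType} A B (f : X -> Y) (g : Y -> Z) :
  {within A, continuous f} -> (forall x, A x -> B (f x)) ->
  {within B, continuous g} -> {within A, continuous (g \o f)}.
Proof.
move=> /subspace_continuousP cf fAB /subspace_continuousP cg.
apply/subspace_continuousP => x Ax.
apply: (@cvg_comp _ _ _ f g _ (within B (nbhs (f x)))); last exact/cg/fAB.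
move=> P; rewrite /within /= => PB.
have {PB} := cf x Ax _ PB; rewrite /within/= /nbhs/= /within/=.
by apply: filterS => z /[swap] Az /(_ Az); apply; exact: fAB.
Qed.

Lemma within_continuousM A (f g : X -> R) :
  {within A, continuous f} -> {within A, continuous g} ->
  {within A, continuous (fun x => f x * g x)}.
Proof. by move=> cf cg x; apply: cvgM; [exact: cf|exact: cg]. Qed.

Lemma within_continuous_cst A (c : R) : {within A, continuous (fun _ : X => c)}.
Proof. by move=> x; exact: cvg_cst. Qed.

Lemma within_continuousXn A (f : X -> R) n :
  {within A, continuous f} -> {within A, continuous (fun x => f x ^+ n)}.
Proof.
move=> cf; elim: n => [|n IH].
  by under eq_fun do rewrite expr0; exact: within_continuous_cst.
by under eq_fun do rewrite exprS; exact: within_continuousM.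
Qed.

End within_topology.

(** * Difference quotients: relative versus ordinary derivatives *)

Section slopes.
Context {R : realType}.
Implicit Types (f g : R -> R) (x d : R).

(** Carathéodory's criterion: the slope function, completed by [d] at [x], is continuous there
    exactly when the slopes tend to [d]. It links the library derivative with [derive_within]. *)
Lemma is_derive_slopeP f x d :
  is_derive x 1 f d <-> (f y - f x) / (y - x) @[y --> x^'] --> d.
Proof.
split.
- move/is_derive1_caratheodory => [g [fg gx <-]].
  have gx' : g @ x^' --> g x by exact/continuous_withinNx.
  apply: cvg_trans gx'; apply: near_eq_cvg; near=> y.
  rewrite fg mulfK// subr_eq0.
  by near: y; exact: nbhs_dnbhs_neq.
- move=> fd; apply/is_derive1_caratheodory.
  exists (fun y => if y == x then d else (f y - f x) / (y - x)); split.
  + move=> y; case: eqP => [->|/eqP yx]; first by rewrite !subrr mulr0.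
    by rewrite divfK// subr_eq0.
  + apply/continuous_withinNx; rewrite eqxx.
    apply: cvg_trans fd; apply: near_eq_cvg; near=> y.
    suff /negbTE -> : y != x by [].
    by near: y; exact: nbhs_dnbhs_neq.
  + by rewrite eqxx.
Unshelve. all: end_near. Qed.

Lemma within_dnbhs_interior (D : set R) x : nbhs x D -> within D x^' = x^'.
Proof.
move=> Dx; rewrite eqEsubset; split => P; rewrite /within/=.
  by apply: filterS2 (nbhs_dnbhs Dx) => y Dy; apply.
by apply: filterS => y Py _.
Qed.

Lemma derivable_within_is_derive (D : set R) f x : nbhs x D ->
  derivable_within D f x -> is_derive x 1 f (derive_within D f x).
Proof.
rewrite /derivable_within /derive_within => /within_dnbhs_interior -> df.
exact/is_derive_slopeP.
Qed.

Lemma is_derive_derivable_within (D : set R) f x d : nbhs x D ->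
  is_derive x 1 f d -> derive_within D f x = d.
Proof.
rewrite /derive_within => /within_dnbhs_interior -> /is_derive_slopeP.
exact/cvg_lim.
Qed.

(** The slope of [F \o f] is the Carathéodory factor of [F] at [f y] times the slope of [f], and
    both factors converge. The filter must be proper for [lim] to pick out this limit. It serves at
    the endpoint 0, where no two-sided derivative is available. *)
Lemma derive_within_comp (D : set R) (F f : R -> R) (x d : R) :
  ProperFilter (within D x^') -> D x ->
  is_derive (f x) 1 F d -> {within D, continuous f} ->
  derivable_within D f x ->
  derive_within D (F \o f) x = d * derive_within D f x.
Proof.
move=> PF Dx /is_derive1_caratheodory [g [Fg gx <-]] cf df.
apply: cvg_lim => //=.
under eq_cvg do rewrite Fg -mulrA.
apply: cvgM; last exact: df.
apply: (@cvg_comp _ _ _ f g _ (nbhs (f x))); last exact: gx.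
have /subspace_continuousP/(_ x Dx) := cf; apply: cvg_trans.
by apply: cvg_app => P PD; exact: nbhs_dnbhs PD.
Qed.

End slopes.

(** * Integration on compact intervals, parameter integrals, uniformity at time 0 *)

Section calculus.
Context {R : realType}.
Local Notation mu := (@lebesgue_measure R).

Lemma within_continuous_slice (S T : set R) (g : R -> R -> R) (t : R) :
  {within S `*` T, continuous (fun p : R * R => g p.1 p.2)} -> S t ->
  {within T, continuous (g t)}.
Proof.
move=> cg St.
apply: (@within_continuous_comp_sub _ _ _ T (S `*` T) (fun x => (t, x))
  (fun p : R * R => g p.1 p.2)) => //.
apply: continuous_subspaceT => x.
by apply: (@cvg_pair _ _ _ _ (nbhs t) (nbhs x)); [exact: cvg_cst|exact: cvg_id].
Qed.

Lemma within_continuous_integrable (f : R -> R) (a b : R) :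
  {within `[a, b], continuous f} -> mu.-integrable `[a, b] (EFin \o f).
Proof. by move=> cf; apply: continuous_compact_integrable => //; exact: segment_compact. Qed.

Lemma Rintegral_FTC (F f : R -> R) (a b : R) : a < b ->
  {within `[a, b], continuous F} -> {within `[a, b], continuous f} ->
  (forall x, x \in `]a, b[ -> is_derive x 1 F (f x)) ->
  \int[mu]_(x in `[a, b]) f x = F b - F a.
Proof.
move=> ab cF cf dF; have [_ Fa Fb] := (continuous_within_itvP F ab).1 cF.
rewrite /Rintegral (@continuous_FTC2 _ f F)//.
- by split => // x /dF [].
- by move=> x /dF [_ <-]; rewrite derive1E.
Qed.

(** Continuity of [dg] on a compact rectangle bounds it there, so a constant dominates the
    derivatives and differentiation under the integral applies. *)
Lemma is_derive_param_integral (g dg : R -> R -> R) (t1 t2 c d t : R) :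
  t1 < t < t2 ->
  (forall s, s \in `]t1, t2[ -> {within `[c, d], continuous (g s)}) ->
  {within `[t1, t2] `*` `[c, d], continuous (fun p : R * R => dg p.1 p.2)} ->
  (forall s x, s \in `]t1, t2[ -> x \in `[c, d] ->
    is_derive s 1 (g ^~ x) (dg s x)) ->
  is_derive t 1 (fun s => \int[mu]_(x in `[c, d]) g s x)
    (\int[mu]_(x in `[c, d]) dg t x).
Proof.
move=> /andP[t1t tt2] cg cdg ddg.
have cptK : compact (`[t1, t2] `*` `[c, d] : set (R * R)).
  by apply: compact_setX; exact: segment_compact.
have /compact_bounded[K [_ Kdg]] := continuous_compact cdg cptK.
have It : `]t1, t2[%classic t by rewrite /= in_itv/= t1t.
have intg s : `]t1, t2[%classic s -> mu.-integrable `[c, d] (EFin \o g s).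
  by move=> /cg; exact: within_continuous_integrable.
have derg s x : `]t1, t2[%classic s -> `[c, d]%classic x -> derivable (g ^~ x) s 1.
  by move=> /ddg /[apply] -[].
have gE s x : `]t1, t2[%classic s -> `[c, d]%classic x ->
    partial1of2 g s x = dg s x.
  by move=> /ddg /[apply] -[_ <-]; rewrite partial1of2E.
(* Boundedness is available for every bound strictly above [K]; this one is also nonnegative. *)
pose G := fun _ : R => `|K| + 1.
have G0 y : 0 <= G y by rewrite /G addr_ge0.
have intG : mu.-integrable `[c, d] (EFin \o G).
  by apply: within_continuous_integrable; exact: within_continuous_cst.
have bG s x : `]t1, t2[%classic s -> `[c, d]%classic x ->
    `|partial1of2 g s x| <= G x.
  move=> Is Ix; rewrite gE//; apply: Kdg; first by rewrite (le_lt_trans (ler_norm _))// ltrDl.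
  exists (s, x) => //; split => //=; move: Is; exact: subset_itv_oo_cc.
have mI : measurable (`[c, d]%classic : set R) by [].
apply: DeriveDef.
  exact: (@derivable_under_integral R _ _ mu g _ mI t t1 t2 It intg derg G G0 intG bG).
rewrite -derive1E.
rewrite (@differentiation_under_integral R _ _ mu g _ mI t t1 t2 It intg derg G G0 intG bG).
by apply: eq_Rintegral => x; rewrite inE => xcd; rewrite gE.
Qed.

(** Compactness of the space interval makes continuity at time 0 uniform in [x]: near each [x], both
    [g t y] and [g 0 y] are within [e / 2] of [g 0 x], and these neighbourhoods cover the
    interval. *)
Lemma within_continuous_uniform_at0 (g : R -> R -> R) (e : R) :
  {within `[0, 1] `*` `[0, 1], continuous (fun p : R * R => g p.1 p.2)} ->
  0 < e ->
  exists2 t, 0 < t & forall x, x \in `[0, 1] -> g t x <= g 0 x + e.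
Proof.
move=> /subspace_continuousP cg e0.
have /compact_near_coveringP/near_covering_withinP cpt := @segment_compact R 0 1.
have : \forall t \near 0^'+, `[0, 1]%classic `<=` (fun x => g t x <= g 0 x + e).
  apply: cpt => x /= x01.
  have D0x : (`[0, 1] `*` `[0, 1]) (0 : R, x : R) by split => //=; rewrite in_itv/= lexx ler01.
  have /cvgrPdist_lt/(_ (e / 2)) := cg _ D0x.
  rewrite divr_gt0// => /(_ isT).
  rewrite /within/= => -[[U V] /= [U0 Vx] UV].
  have U0' : \forall t \near 0^'+, U t by exact: cvg_within.
  exists (V, [set t | U t /\ 0 < t <= 1]) => /=.
    split => //; near=> t; split.
      by near: t; exact: U0'.
    apply/andP; split.
      by near: t; exact: nbhs_right_gt.
    by near: t; apply: nbhs_right_le.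
  move=> [y t] /= [Vy [Ut /andP[t0 t1]]] y01.
  have h1 : `|g 0 x - g t y| < e / 2.
    by apply: (UV (t, y)) => //=; split => //=; rewrite in_itv/= (ltW t0).
  have h2 : `|g 0 x - g 0 y| < e / 2.
    apply: (UV (0, y)) => //=; first by split => //; exact: nbhs_singleton U0.
    by split => //=; rewrite in_itv/= lexx ler01.
  move: h1 h2; rewrite !ltr_norml => /andP[h1 _] /andP[_ h2]; lra.
move=> H; near (0:R)^'+ => t; exists t.
  by near: t; exact: nbhs_right_gt.
by near: t; exact: H.
Unshelve. all: end_near. Qed.

End calculus.

(** * Derivative of [A], affine bound on [B], and a Gronwall-type inequality *)

Section constitutive.
Context {R : realType}.
Local Notation mu := (@lebesgue_measure R).

Lemma integrable_setU_disjoint d (T : measurableType d) (m : {measure set T -> \bar R})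
    (S1 S2 : set T) (f : T -> \bar R) :
  measurable S1 -> measurable S2 -> [disjoint S1 & S2] ->
  m.-integrable S1 f -> m.-integrable S2 f -> m.-integrable (S1 `|` S2) f.
Proof.
move=> mS1 mS2 S12 /integrableP[mf1 if1] /integrableP[mf2 if2].
have mf := (measurable_funU _ mS1 mS2).2 (conj mf1 mf2).
apply/integrableP; split => //.
rewrite ge0_integral_setU//; last exact: measurableT_comp.
exact: lte_add_pinfty.
Qed.

(** Near [r], [A] differs by a constant from the integral of [a] starting at [r / 2], to which the
    fundamental theorem applies. Integrability down to [r / 2] follows from continuity of [a] on the
    compact piece up to 1. *)
Lemma is_derive_tail_integral (a A : R -> R) (r : R) :
  {in `]0, +oo[, forall s, derivable a s 1} ->
  mu.-integrable `]1, +oo[ (EFin \o a) ->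
  (forall s, 0 < s -> A s = - \int[mu]_(x in `]s, +oo[) a x) ->
  0 < r -> is_derive r 1 A (a r).
Proof.
move=> da ia AE r0.
have r20 : 0 < r / 2 by rewrite divr_gt0.
have ca s : 0 < s -> {for s, continuous a}.
  move=> s0; apply/differentiable_continuous; rewrite -derivable1_diffP.
  by apply: da; rewrite in_itv/= s0.
have ia2 : mu.-integrable `]r / 2, +oo[ (EFin \o a).
  have [r1|r1] := leP 1 (r / 2).
    by apply: integrableS ia => //; apply: subset_itvr; rewrite bnd_simp.
  rewrite (@itv_bndbnd_setU _ _ _ (BRight 1))//; last by rewrite bnd_simp ltW.
  apply: integrable_setU_disjoint => //.
    apply/disj_setPS => x /= []; rewrite !in_itv/= andbT => /andP[_ x1].
    by rewrite ltNge x1.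
  have ia1 : mu.-integrable `[r / 2, 1] (EFin \o a).
    apply: within_continuous_integrable; apply: continuous_in_subspaceT => x.
    rewrite inE/= in_itv/= => /andP[rx _]; apply: ca; exact: lt_le_trans rx.
  by apply: integrableS ia1 => //; exact: subset_itv_oc_cc.
pose F x := \int[mu]_(t in `]r / 2, x]) a t.
have [dF F'] : derivable F r 1 /\ derive1 F r = a r.
  apply: (@continuous_FTC1 _ a (BRight (r / 2)) r (r + 1)).
  - by rewrite ltrDl.
  - by apply: integrableS ia2 => //; exact: subset_itvl.
  - by rewrite lte_fin; lra.
  - exact: ca.
pose c := \int[mu]_(t in `]r / 2, +oo[) a t.
have AF : \near r, F r - c = A r.
  near=> s.
  have rs : r / 2 < s by near: s; apply: lt_nbhsr; lra.
  rewrite AE ?(lt_trans r20)// -(@Rintegral_itvB _ a (BRight (r / 2)) _ s)//.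
  - by rewrite opprB.
  - by rewrite bnd_simp ltW.
apply: near_eq_is_derive AF _.
have dFr : is_derive r 1 F (a r) by apply: DeriveDef => //; rewrite -derive1E.
apply: (@is_derive_eq _ _ _ (F - cst c)).
by rewrite subr0.
Unshelve. all: end_near. Qed.

(** Beyond some [r0], sublinearity gives [B r <= e * r]. Below [r0], concavity together with
    nonnegativity at [2 * r0] bounds [B r] by a constant, even as [r] tends to 0. *)
Lemma concave_sublinear_affine_bound (B : R -> R) (e : R) :
  convex_function (`]0, +oo[%classic : set R) (\- B) ->
  (forall r, 0 < r -> 0 <= B r) ->
  B r / r @[r --> +oo] --> 0 -> 0 < e ->
  exists2 C, 0 < C & forall r, 0 < r -> B r <= e * r + C.
Proof.
move=> cB B0 Bo e0.
have /cvgrPdist_lt/(_ _ e0) Be := Bo.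
have [r0 [r00 r0P]] : exists r0, 0 < r0 /\ forall r, r0 <= r -> B r <= e * r.
  have [M [_ MP]] := Be.
  exists (`|M| + 1); split; first by rewrite ltr_wpDl.
  move=> r rM; have r0 : 0 < r by rewrite (lt_le_trans _ rM)// ltr_wpDl.
  have /MP : M < r by rewrite (lt_le_trans _ rM)// (le_lt_trans (ler_norm _))// ltrDl.
  rewrite /= sub0r normrN => /(le_lt_trans (ler_norm _)).
  by rewrite ltr_pdivrMr// => /ltW.
(* The bound for [r < r0] is [2 * B r0]; adding 1 makes the constant strictly positive. *)
exists (2 * B r0 + 1); first by rewrite ltr_wpDl// mulr_ge0// B0.
move=> r r_gt0; have [/r0P|rr0] := leP r0 r.
  by move=> /le_trans; apply; rewrite lerDl addr_ge0// mulr_ge0// B0.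
(* [r0] is a convex combination of [r] and [2 * r0] in which [r] has weight at least 1/2. *)
suff : B r <= 2 * B r0 by have := mulr_ge0 (ltW e0) (ltW r_gt0); lra.
have d0 : 0 < 2 * r0 - r by lra.
pose t := r0 / (2 * r0 - r).
have t01 : 0 <= t <= 1.
  by rewrite /t divr_ge0 ?(ltW r00) ?(ltW d0)//= ler_pdivrMr// mul1r; lra.
have := @cB (Itv01 (andP t01).1 (andP t01).2) r (2 * r0).
rewrite !inE /= !in_itv/= !andbT r_gt0 mulr_gt0// => /(_ isT isT).
rewrite !convRE /= /unstable.onem.
set c := conv _ _ _; have -> : c = r0.
  transitivity (t * r + (1 - t) * (2 * r0)); first by [].
  by rewrite /t; field; rewrite gt_eqF.
have := B0 _ (mulr_gt0 (ltr0n R 2) r00); move: (B (2 * r0)) => B2 B20.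
have t12 : 1 / 2 <= t by rewrite /t ler_pdivlMr//; lra.
have : (1 / 2) * B r <= t * B r by rewrite ler_wpM2r// B0.
have : 0 <= (1 - t) * B2 by rewrite mulr_ge0// subr_ge0; lra.
lra.
Qed.

(** With the integrating factor [E t = expR (- K * t)], the function [E * (L - k / K)] is
    nonincreasing. If it were negative at [t0], then [L - k / K] would decrease at least
    exponentially fast and [L] would become negative. *)
Lemma gronwall_nonneg (L dL : R -> R) (K k t0 : R) :
  0 < K -> 0 < k -> 0 < t0 ->
  (forall t : R, 0 < t -> is_derive t 1 L (dL t)) ->
  (forall t : R, 0 < t -> dL t <= K * L t - k) ->
  (forall t : R, 0 < t -> 0 <= L t) ->
  k / K <= L t0.
Proof.
move=> K0 k0 t00 dLP dLle L0; rewrite leNgt; apply/negP => Lt0.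
pose E : R -> R := expR \o (- K \*: (id : R -> R)).
pose g : R -> R := E * (L - cst (k / K)).
have EE t : E t = expR (- K * t) by [].
have dg (t : R) : 0 < t -> is_derive t 1 g (E t * (dL t - K * L t + k)).
  move=> t_gt0; have dLt := dLP _ t_gt0.
  have dE : is_derive t 1 E (E t * - K).
    by apply: is_derive_eq; rewrite /GRing.scale/= mulr1.
  rewrite /g; apply: is_derive_eq; rewrite /GRing.scale/= /cst !fctE; field.
  by rewrite gt_eqF.
have g_nincr (t : R) : t0 <= t -> g t <= g t0.
  apply: ler0_derive1_nincry => //.
  - by move=> x; rewrite in_itv/= andbT => t0x; have [] := dg x (lt_trans t00 t0x).
  - move=> x; rewrite in_itv/= andbT => t0x; have x0 := lt_trans t00 t0x.
    have [_ dgx] := dg x x0; rewrite derive1E dgx.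
    rewrite mulr_ge0_le0 ?expR_ge0//; have := dLle _ x0; lra.
  - apply: continuous_in_subspaceT => x; rewrite inE/= in_itv/= andbT => t0x.
    apply/differentiable_continuous; rewrite -derivable1_diffP.
    by have [] := dg x (lt_le_trans t00 t0x).
have g0 : g t0 < 0 by rewrite /g !fctE pmulr_rlt0 ?expR_gt0// subr_lt0.
have kK0 : 0 < k / K by rewrite divr_gt0.
(* Chosen so that [- g t0 * (1 + K * t)] exceeds [k / K]: the linear lower bound on the exponential
   then already contradicts [0 <= L t]. *)
pose t := t0 + (k / K) / (- g t0) / K.
have dt0 : 0 < (k / K) / (- g t0) / K by rewrite !divr_gt0// oppr_gt0.
have t_gt0 : 0 < t by rewrite addr_gt0.
have := g_nincr t; rewrite lerDl (ltW dt0) => /(_ isT).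
apply/negP; rewrite -ltNge.
rewrite [ltRHS]/g !fctE EE.
have LB : - (k / K) <= L t - k / K by rewrite -subr_ge0 opprK subrK L0.
apply: (@lt_le_trans _ _ (expR (- K * t) * - (k / K))); last first.
  by rewrite ler_wpM2l// expR_ge0.
rewrite mulrN ltrNr mulNr expRN mulrC ltr_pdivrMr ?expR_gt0//.
have : 1 + K * t <= expR (K * t) by exact: expR_ge1Dx.
rewrite -(ler_pM2l (_ : 0 < - g t0)) ?oppr_gt0// => /(lt_le_trans _); apply.
rewrite mulrDr mulr1 /t !mulrDr.
have -> : - g t0 * (K * (k / K / - g t0 / K)) = k / K.
  by field; rewrite (gt_eqF K0) (lt_eqF g0).
have : 0 < - g t0 * (K * t0) by rewrite !mulr_gt0// oppr_gt0.
by move: g0; lra.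
Qed.

End constitutive.

(** * The integration by parts and the estimate of the cubic moment at a fixed time *)

Section energy.
Context {R : realType}.
Local Notation mu := (@lebesgue_measure R).

(** Here [w], [U], [al], [dal] stand for [u], its mass function, [A(u)] and [A(u)_x] at a fixed
    time. Shifting [al] by [e] leaves its derivative unchanged and turns the affine bound into
    [w * (al + e) >= - C]. The boundary values of [U] produce [M^4/4 - M^4/3 = - M^4/12]. *)
Lemma energy_inequality (w U al dal : R -> R) (M e C d : R) :
  0 <= C -> 0 < d ->
  {within `[0, 1], continuous w} -> {within `[0, 1], continuous U} ->
  {within `[0, 1], continuous al} -> {within `[0, 1], continuous dal} ->
  (forall x : R, x \in `]0, 1[ -> is_derive x 1 U (w x)) ->
  (forall x : R, x \in `]0, 1[ -> is_derive x 1 al (dal x)) ->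
  U 0 = 0 -> U 1 = M -> al 1 <= 0 ->
  (forall x : R, x \in `[0, 1] -> 0 <= U x) ->
  (forall x : R, x \in `[0, 1] -> - w x * al x <= e * w x + C) ->
  \int[mu]_(x in `[0, 1]) (U x ^+ 2 * (dal x + w x * (U x - M * x)))
    <= M ^+ 2 * e - M ^+ 4 / 12 + 2 * C * d
       + (M / 3 + 2 * C / d ^+ 2) * \int[mu]_(x in `[0, 1]) U x ^+ 3.
Proof.
move=> C0 d0 cw cU cal cdal dU ddal U0 U1 al1 Uge0 walC.
have cid : {within `[0, 1], continuous (id : R -> R)}.
  by apply: continuous_subspaceT => x; exact: cvg_id.
have cc (c : R) : {within `[0, 1], continuous (fun _ : R => c)}.
  exact: within_continuous_cst.
(* [Q] performs the integration by parts: besides the integrand on the left, [q] only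
   contains a term bounded below through [walC], the [U ^+ 3] term and a constant. *)
pose Q x := U x ^+ 2 * (al x + e) + 4^-1 * U x ^+ 4 - M / 3 * (x * U x ^+ 3)
  + 2 * C * d * x.
pose q := fun x => U x ^+ 2 * (dal x + w x * (U x - M * x))
  + 2 * U x * w x * (al x + e) - M / 3 * U x ^+ 3
  + 2 * C * d.
have dQ (x : R) : x \in `]0, 1[ -> is_derive x 1 Q (q x).
  move=> x01; have dUx := dU _ x01; have dalx := ddal _ x01.
  have -> : Q = U ^+ 2 * (al + cst e) + 4^-1 \*: U ^+ 4
      - (M / 3) \*: ((id : R -> R) * U ^+ 3) + (2 * C * d) \*: (id : R -> R).
    by apply/funext => y; rewrite /Q /= !fctE.
  apply: is_derive_eq.
  rewrite /GRing.scale/= /cst /q !fctE; by field.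
have cQ : {within `[0, 1], continuous Q}.
  apply: within_continuousD; last exact: within_continuousM.
  apply: within_continuousB; first apply: within_continuousD.
  - apply: within_continuousM; first exact: within_continuousXn.
    by apply: within_continuousD.
  - by apply: within_continuousM => //; exact: within_continuousXn.
  - apply: within_continuousM => //; apply: within_continuousM => //.
    exact: within_continuousXn.
have cJ : {within `[0, 1], continuous
    (fun x => U x ^+ 2 * (dal x + w x * (U x - M * x)))}.
  apply: within_continuousM; first exact: within_continuousXn.
  apply: within_continuousD => //; apply: within_continuousM => //.
  by apply: within_continuousB => //; exact: within_continuousM.
have cU3 : {within `[0, 1], continuous (fun x => U x ^+ 3)}.
  exact: within_continuousXn.
have cq : {within `[0, 1], continuous q}.
  apply: within_continuousD => //.
  apply: within_continuousB; first apply: within_continuousD => //.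
    apply: within_continuousM; last exact: within_continuousD.
    by apply: within_continuousM => //; exact: within_continuousM.
  exact: within_continuousM.
set k := M / 3 + 2 * C / d ^+ 2.
have k01 : 0 < (1 : R) by [].
have intq := Rintegral_FTC _ _ _ _ k01 cQ cq dQ.
have iq := within_continuous_integrable _ _ _ cq.
have iU3 := within_continuous_integrable _ _ _ cU3.
(* The left integrand is at most [q + k * U ^+ 3] pointwise, and [q] integrates exactly to
   [Q 1 - Q 0]. *)
apply: (@le_trans _ _ (\int[mu]_(x in `[0, 1]) (q x + k * U x ^+ 3))).
  apply: le_Rintegral => //.
  - exact: within_continuous_integrable.
  - apply: within_continuous_integrable; apply: within_continuousD => //.
    exact: within_continuousM.
  - move=> x /= x01; rewrite /q.
    have Ux0 := Uge0 _ x01; have walx := walC _ x01.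
    have h1 : - (2 * U x * C) <= 2 * U x * w x * (al x + e).
      have -> : 2 * U x * w x * (al x + e) = 2 * U x * (w x * al x + e * w x) by ring.
      rewrite -mulrN ler_wpM2l ?mulr_ge0//; lra.
    (* Either [U x <= d], or [U x / d > 1] and the cubic term alone dominates. *)
    have h2 : U x <= d + U x ^+ 3 / d ^+ 2.
      have [Ud|dU'] := leP (U x) d.
        by rewrite (le_trans Ud)// lerDl divr_ge0// ?exprn_ge0// ltW.
      rewrite -[leLHS]add0r lerD// ?(ltW d0)// ler_pdivlMr ?exprn_gt0//.
      rewrite [leRHS]exprS ler_wpM2l// lerXn2r// ?nnegrE ltW//.
    have h3 : 2 * C * U x <= 2 * C * d + 2 * C / d ^+ 2 * U x ^+ 3.
      have -> : 2 * C * d + 2 * C / d ^+ 2 * U x ^+ 3 = 2 * C * (d + U x ^+ 3 / d ^+ 2).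
        by ring.
      by rewrite ler_wpM2l// mulr_ge0.
    move: h1 h3; rewrite /k mulrDl; lra.
rewrite RintegralD//; last first.
  by apply: within_continuous_integrable; exact: within_continuousM.
rewrite intq RintegralZl// lerD2r /Q U0 U1.
have : M ^+ 2 * al 1 <= 0 by rewrite mulr_ge0_le0// sqr_ge0.
lra.
Qed.

End energy.

(** * The mass function of a hypothetical global solution *)

Section solution.
Context {R : realType} (a A : R -> R) (M m0 : R) (u0 : R -> R) (u v : R -> R -> R).
Local Notation mu := (@lebesgue_measure R).
Context (da : {in `]0, +oo[, forall r, derivable a r 1})
  (dA : forall r : R, 0 < r -> is_derive r 1 A (a r))
  (m0M : 0 < m0 < M) (sol : classical_solution a A M m0 u0 +oo%E u v).

(* Since [v_x = 0] at [0] and [v_xx = M - u], [U t x] is the mass of [u t] on [[0, x]];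
   [J] is its time derivative. *)
Let U (t x : R) := M * x - dx v t x.
Let J (t x : R) := a (u t x) * dx u t x - u t x * dx v t x.

Let time_ooy (t : R) : 0 < t -> time_oo +oo%E t.
Proof. by move=> t0; split => //; rewrite ltry. Qed.

Let u_gt0 (t x : R) : 0 < t -> x \in `[0, 1] -> 0 < u t x.
Proof.
move=> t0 x01; have /andP[m00 m0M'] := m0M; have M0 := lt_trans m00 m0M'.
have tc : time_co +oo%E t by split; [exact: ltW|rewrite ltry].
apply: lt_le_trans (cs_u_lower sol tc x01).
by rewrite divr_gt0 ?mulr_gt0// addr_gt0// mulr_gt0 ?expR_gt0// subr_gt0.
Qed.

Let nbhs01 (x : R) : x \in `]0, 1[ -> nbhs x `[0, 1]%classic.
Proof.
move=> x01; apply: (@filterS _ _ _ `]0, 1[%classic); first exact: subset_itv_oo_cc.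
by apply: near_in_itvoo.
Qed.

Let oo_cc (x : R) : x \in `]0, 1[ -> x \in `[0, 1].
Proof. exact: subset_itv_oo_cc. Qed.

Let cont_slice (w : R -> R -> R) (t : R) : continuous_in (time_oo +oo%E) w -> 0 < t ->
  {within `[0, 1], continuous (w t)}.
Proof. by move=> cw t0; apply: within_continuous_slice cw _; exact: time_ooy. Qed.

Lemma is_derive_dx (w : R -> R -> R) (t x : R) :
  (forall t x, time_oo +oo%E t -> x \in `[0, 1] -> derivable_within `[0, 1] (w t) x) ->
  0 < t -> x \in `]0, 1[ -> is_derive x 1 (w t) (dx w t x).
Proof.
move=> dw t0 x01; apply: derivable_within_is_derive; first exact: nbhs01.
by apply: dw; [exact: time_ooy|exact: oo_cc].
Qed.

Let du (t x : R) : 0 < t -> x \in `]0, 1[ -> is_derive x 1 (u t) (dx u t x).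
Proof.
by apply: is_derive_dx => s y s0 y01; have [+ _ _ _ _] := cs_C12_u sol => /(_ s y s0 y01)[].
Qed.

Let ddu (t x : R) : 0 < t -> x \in `]0, 1[ -> is_derive x 1 (dx u t) (dx (dx u) t x).
Proof.
by apply: is_derive_dx => s y s0 y01; have [+ _ _ _ _] := cs_C12_u sol => /(_ s y s0 y01)[].
Qed.

Let ddv (t x : R) : 0 < t -> x \in `]0, 1[ -> is_derive x 1 (dx v t) (M - u t x).
Proof.
move=> t0 x01; have -> : M - u t x = dx (dx v) t x.
  by have := cs_v_eq sol (time_ooy _ t0) x01; lra.
move: t0 x01.
by apply: is_derive_dx => s y s0 y01; have [+ _ _ _ _] := cs_C12_v sol => /(_ s y s0 y01)[].
Qed.

Let dU (t x : R) : 0 < t -> x \in `]0, 1[ -> is_derive x 1 (U t) (u t x).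
Proof.
move=> t0 x01; have := ddv _ _ t0 x01 => dvx.
have -> : U t = (M \*: (id : R -> R)) - dx v t by apply/funext.
by apply: is_derive_eq; rewrite /GRing.scale/= mulr1 subKr.
Qed.

Let dAu (t x : R) : 0 < t -> x \in `]0, 1[ ->
  is_derive x 1 (A \o u t) (a (u t x) * dx u t x).
Proof.
move=> t0 x01; apply: is_derive1_comp; first exact/dA/u_gt0/oo_cc.
exact: du.
Qed.

Let cu (t : R) : 0 < t -> {within `[0, 1], continuous (u t)}.
Proof. by apply: cont_slice; have [] := cs_C12_u sol. Qed.

Let ca : {within `]0, +oo[, continuous a}.
Proof.
apply: continuous_in_subspaceT => r r0; apply/differentiable_continuous.
by rewrite -derivable1_diffP; apply: da; rewrite inE in r0.
Qed.

Let c_diffusion : continuous_in (time_oo +oo%E) (fun t x => a (u t x) * dx u t x).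
Proof.
have [_ cu2 _ cux _] := cs_C12_u sol.
apply: within_continuousM => //.
apply: (@within_continuous_comp_sub (R * R)%type R R _ `]0, +oo[%classic
  (fun p : R * R => u p.1 p.2) a) => //.
by move=> [t x] /= [[t0 _] x01]; rewrite in_itv/= andbT u_gt0.
Qed.

Let cJ : continuous_in (time_oo +oo%E) J.
Proof.
have [_ cu2 _ cux _] := cs_C12_u sol; have [_ cv2 _ cvx2 _] := cs_C12_v sol.
apply: within_continuousB; first exact: c_diffusion.
exact: within_continuousM.
Qed.

Let cU : continuous_in (time_oo +oo%E) U.
Proof.
have [_ cv2 _ cvx2 _] := cs_C12_v sol.
apply: within_continuousB => //.
apply: continuous_subspaceT => p; apply: cvgM; first exact: cvg_cst.
exact: cvg_snd.
Qed.

Let cAu (t : R) : 0 < t -> {within `[0, 1], continuous (A \o u t)}.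
Proof.
move=> t0; apply: (@within_continuous_comp_sub R R R _ `]0, +oo[%classic (u t) A) => //.
- exact: cu.
- by move=> x x01 /=; rewrite in_itv/= andbT u_gt0.
- apply: continuous_in_subspaceT => r; rewrite inE/= in_itv/= andbT => r0.
  apply/differentiable_continuous; rewrite -derivable1_diffP.
  by have [] := dA _ r0.
Qed.

(** * Boundary values and monotonicity of the mass function, and its flux *)

Let U0 (t : R) : 0 < t -> U t 0 = 0.
Proof.
by move=> t0; rewrite /U (cs_v_bc sol (time_ooy _ t0)).1 mulr0 subr0.
Qed.

Let U1 (t : R) : 0 < t -> U t 1 = M.
Proof.
by move=> t0; rewrite /U (cs_v_bc sol (time_ooy _ t0)).2 mulr1 subr0.
Qed.

Let U_mono (t x y : R) : 0 < t -> 0 <= x -> x <= y -> y <= 1 -> U t x <= U t y.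
Proof.
move=> t0; apply: ger0_derive1_ndecr => z.
- by move=> /dU - /(_ _ t0)[].
- move=> z01; have [_ dUz] := dU _ _ t0 z01.
  by rewrite derive1E dUz ltW// u_gt0// oo_cc.
- exact: (cont_slice _ _ cU t0).
Qed.

(** The boundary condition concerns [A(u)_x]; the one-sided chain rule identifies it with
    [a(u) u_x], while [v_x] vanishes at 0. *)
Let J0 (t : R) : 0 < t -> J t 0 = 0.
Proof.
move=> t0; have [v0 _] := cs_v_bc sol (time_ooy _ t0).
rewrite /J v0 mulr0 subr0.
have [dAu0 _] := cs_u_bc sol (time_ooy _ t0).
transitivity (derive_within `[0, 1] (A \o u t) 0); last exact: dAu0.
have z01 : (0 : R) \in `[0, 1] by rewrite in_itv/= lexx ler01.
(* Small positive points lie in the unit interval and differ from 0, so the deleted trace filter is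
   proper. *)
have PF : ProperFilter (within `[0, 1] (0:R)^').
  apply: Build_ProperFilter_ex => P; rewrite /within/= /dnbhs/= /within/= => nP.
  have : \forall x \near (0:R)^'+, P x.
    near=> x.
    have : x != 0 -> x \in `[0, 1] -> P x by near: x; exact: cvg_within.
    apply; first by rewrite gt_eqF//; near: x; exact: nbhs_right_gt.
    rewrite in_itv/=; apply/andP; split; near: x; first exact: nbhs_right_ge.
    exact: nbhs_right_le.
  by move=> /filter_ex.
have dA0 := dA _ (u_gt0 _ _ t0 z01).
rewrite (derive_within_comp _ _ _ _ _ PF _ dA0)//.
- exact: cu.
- by have [+ _ _ _ _] := cs_C12_u sol => /(_ t 0 (time_ooy _ t0) z01)[].
Unshelve. all: end_near. Qed.

Let dJ (t x : R) : 0 < t -> x \in `]0, 1[ -> is_derive x 1 (J t) (dt u t x).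
Proof.
move=> t0 x01.
have dux := du _ _ t0 x01; have ddux := ddu _ _ t0 x01.
have dvx := ddv _ _ t0 x01.
have dax : is_derive (u t x) 1 a (derive1 a (u t x)).
  rewrite derive1E; apply: derivableP; apply: da.
  by rewrite in_itv/= andbT u_gt0// oo_cc.
(* The equation only gives the value of a [lim]; existence of the derivative has to come from the
   regularity of [u], [v] and [a]. *)
have [d dJ] : exists d, is_derive x 1 (J t) d.
  have -> : J t = (a \o u t) * dx u t - u t * dx v t by apply/funext.
  by eexists; apply: is_deriveB.
suff -> : dt u t x = d by [].
rewrite (cs_u_eq sol (time_ooy _ t0) x01).
by apply: is_derive_derivable_within => //; exact: nbhs01.
Qed.

(** * Time derivatives of the mass function and of its cubic moment *)

Let within_rect (w : R -> R -> R) (t x : R) : continuous_in (time_oo +oo%E) w -> 0 < t -> x <= 1 ->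
  {within `[t / 2, t * 2] `*` `[0, x], continuous (fun p : R * R => w p.1 p.2)}.
Proof.
move=> cw t0 x1; apply: continuous_subspaceW cw => -[s y] /= [].
rewrite !in_itv/= => /andP[ts _] /andP[y0 yx]; split.
  by apply: time_ooy; apply: lt_le_trans ts; rewrite divr_gt0.
by rewrite y0 (le_trans yx).
Qed.

Let t_mid (t : R) : 0 < t -> t / 2 < t < t * 2.
Proof. by move=> t0; apply/andP; split; lra. Qed.

Let mid_gt0 (t s : R) : 0 < t -> s \in `]t / 2, t * 2[ -> 0 < s.
Proof. by move=> t0; rewrite in_itv/= => /andP[ts _]; apply: lt_trans ts; rewrite divr_gt0. Qed.

(** [U s x] is the integral of [u s] over [[0, x]]. Differentiating under the integral and using
    [u_t = J_x] with [J t 0 = 0] leaves [J t x]. *)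
Let dtU (t x : R) : 0 < t -> x \in `[0, 1] -> is_derive t 1 (U ^~ x) (J t x).
Proof.
(* The case [x = 0] is separate, since the fundamental theorem is used on a nondegenerate interval;
   there both sides vanish. *)
move=> t0; rewrite in_itv/= => /andP[]; rewrite le_eqVlt => /predU1P[<- _|x0 x1].
  rewrite J0//; apply: (@near_eq_is_derive _ _ _ (cst 0)).
  near=> s; rewrite /= U0//; near: s; exact: lt_nbhsr.
have sub y : y \in `]0, x[ -> y \in `]0, 1[.
  by rewrite !in_itv/= => /andP[-> yx]; rewrite (lt_le_trans yx).
have itvS : `[0, x] `<=` `[0, 1].
  by apply: subset_itvl; rewrite bnd_simp.
have UE s : 0 < s -> \int[mu]_(y in `[0, x]) u s y = U s x.
  move=> s0; rewrite -[RHS]subr0 -[in RHS](U0 _ s0).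
  apply: Rintegral_FTC => //; last by move=> y /sub; exact: dU.
  - by apply: continuous_subspaceW itvS _; exact: cont_slice.
  - by apply: continuous_subspaceW itvS _; exact: cu.
have [du2 _ cdtu _ _] := cs_C12_u sol.
have -> : J t x = \int[mu]_(y in `[0, x]) dt u t y.
  rewrite -[LHS]subr0 -[in LHS](J0 _ t0); apply/esym.
  apply: Rintegral_FTC => //; last by move=> y /sub; exact: dJ.
  - by apply: continuous_subspaceW itvS _; exact: cont_slice.
  - by apply: continuous_subspaceW itvS _; exact: cont_slice.
apply: (@near_eq_is_derive _ _ _ (fun s => \int[mu]_(y in `[0, x]) u s y)).
  by near=> s; rewrite UE//; near: s; exact: lt_nbhsr.
apply: (@is_derive_param_integral _ u (dt u) (t / 2) (t * 2)).
- exact: t_mid.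
- move=> s /(mid_gt0 _ _ t0) s0; apply: continuous_subspaceW itvS _; exact: cu.
- exact: within_rect.
- move=> s y /(mid_gt0 _ _ t0) s0 /itvS y01.
  have [dts _ _] := du2 s y (time_ooy _ s0) y01.
  by rewrite /dt derive1E; exact: derivableP.
Unshelve. all: end_near. Qed.

Lemma is_derive_moment (t : R) : 0 < t ->
  is_derive t 1 (fun s => \int[mu]_(x in `[0, 1]) U s x ^+ 3)
    (\int[mu]_(x in `[0, 1]) (3 * (U t x ^+ 2 * J t x))).
Proof.
move=> t0.
apply: (@is_derive_param_integral _ (fun s x => U s x ^+ 3)
  (fun s x => 3 * (U s x ^+ 2 * J s x)) (t / 2) (t * 2)).
- exact: t_mid.
- move=> s /(mid_gt0 _ _ t0) s0; apply: within_continuousXn; exact: cont_slice.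
- apply: (within_rect (fun s x => 3 * (U s x ^+ 2 * J s x))) => //.
  apply: within_continuousM; first exact: within_continuous_cst.
  apply: within_continuousM => //; exact: within_continuousXn.
- move=> s x /(mid_gt0 _ _ t0) s0 x01; have dUs := dtU _ _ s0 x01.
  have -> : (fun s => U s x ^+ 3) = (U ^~ x) ^+ 3 by apply/funext => y; rewrite fctE.
  by apply: is_derive_eq; rewrite /GRing.scale/=; ring.
Qed.

(** Both error terms equal [M^4/48], so tripling the energy inequality gives the constant
    [3 * (1/48 - 1/12 + 1/48) = - 1/8] times [M^4] and the factor [M + 6 * C / d ^+ 2] on the
    moment; the Gronwall argument concludes. *)
Lemma moment_lower_bound (C d t : R) : 0 < C -> 0 < d -> 2 * C * d = M ^+ 4 / 48 ->
  (forall r : R, 0 < r -> 0 <= - r * A r <= M ^+ 2 / 48 * r + C) -> 0 < t ->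
  M ^+ 4 / 8 / (M + 6 * C / d ^+ 2) <= \int[mu]_(x in `[0, 1]) U t x ^+ 3.
Proof.
move=> C0 d0 Cd AB t0; have /andP[m00 m0M'] := m0M; have M0 := lt_trans m00 m0M'.
have K0 : 0 < M + 6 * C / d ^+ 2 by rewrite addr_gt0// divr_gt0 ?mulr_gt0 ?exprn_gt0.
pose dL s := \int[mu]_(x in `[0, 1]) (3 * (U s x ^+ 2 * J s x)).
apply: (gronwall_nonneg (fun s => \int[mu]_(x in `[0, 1]) U s x ^+ 3) dL) => //.
- by rewrite divr_gt0// exprn_gt0.
- exact: is_derive_moment.
- move=> s s0.
  have UU x : x \in `[0, 1] -> 0 <= U s x.
    by rewrite in_itv/= => /andP[x0 x1]; rewrite -(U0 _ s0) U_mono.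
  have z11 : (1 : R) \in `[0, 1] by rewrite in_itv/= lexx ler01.
  have cAx : {within `[0, 1], continuous (fun x => a (u s x) * dx u s x)}.
    exact: (cont_slice _ _ c_diffusion).
  have A1 : A (u s 1) <= 0.
    have us1 := u_gt0 _ _ s0 z11; have /andP[+ _] := AB _ us1.
    by rewrite mulNr oppr_ge0 pmulr_rle0.
  have := @energy_inequality R (u s) (U s) (A \o u s)
    (fun x => a (u s x) * dx u s x) M (M ^+ 2 / 48) C d (ltW C0) d0
    (cu _ s0) (cont_slice _ _ cU s0) (cAu _ s0) cAx
    (fun x => dU s x s0) (fun x => dAu s x s0) (U0 _ s0) (U1 _ s0) A1 UU.
  have Wl x : x \in `[0, 1] -> - u s x * (A \o u s) x <= M ^+ 2 / 48 * u s x + C.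
    by move=> x01; have /andP[] := AB _ (u_gt0 _ _ s0 x01).
  move=> /(_ Wl).
  have iJ : mu.-integrable `[0, 1] (EFin \o (fun x => U s x ^+ 2 * J s x)).
    apply: within_continuous_integrable; apply: within_continuousM.
      by apply: within_continuousXn; exact: cont_slice.
    exact: (cont_slice _ _ cJ).
  have -> : dL s = 3 * \int[mu]_(x in `[0, 1]) (U s x ^+ 2 * J s x).
    by rewrite -RintegralZl.
  have -> : \int[mu]_(x in `[0, 1])
      (U s x ^+ 2 * (a (u s x) * dx u s x + u s x * (U s x - M * x))) =
      \int[mu]_(x in `[0, 1]) (U s x ^+ 2 * J s x).
    by apply: eq_Rintegral => x _; rewrite /J /U; ring.
  rewrite Cd; set I := \int[mu]_(x in _) _; set L := \int[mu]_(x in _) _.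
  have -> : (M / 3 + 2 * C / d ^+ 2) * L = (M + 6 * C / d ^+ 2) * L / 3 by field; rewrite gt_eqF.
  have -> : M ^+ 2 * (M ^+ 2 / 48) = M ^+ 4 / 48 by field.
  lra.
- move=> s s0; apply: Rintegral_ge0 => x /=.
  rewrite in_itv/= => /andP[x0 x1].
  by rewrite exprn_ge0// -(U0 _ s0) U_mono.
Qed.

(** [U] involves [dx v], whose regularity is given for positive times only, so the data are compared
    at a small [t > 0] where [u t <= u0 + e]. Integration gives [U t <= W], and [0 <= U <= M] gives
    [U^3 <= M^2 U]. *)
Lemma initial_moment_bound (W : R -> R) (e : R) : 0 < e ->
  {within `[0, 1], continuous W} -> W 0 = 0 ->
  (forall x : R, x \in `]0, 1[ -> is_derive x 1 W (u0 x + e)) ->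
  exists2 t : R, 0 < t &
    \int[mu]_(x in `[0, 1]) U t x ^+ 3 <= M ^+ 2 * \int[mu]_(x in `[0, 1]) W x.
Proof.
move=> e0 cW W0 dW; have /andP[m00 m0M'] := m0M; have M0 := lt_trans m00 m0M'.
have cu0 : {within `[0, 1] `*` `[0, 1], continuous (fun p : R * R => u p.1 p.2)}.
  apply: continuous_subspaceW (cs_continuous_u sol) => -[s y] /= [].
  by rewrite in_itv/= => /andP[s0 _] y01; split => //; split => //; rewrite ltry.
have [t t0 ut] := within_continuous_uniform_at0 _ _ cu0 e0; exists t => //.
have UW x : x \in `[0, 1] -> U t x <= W x.
  rewrite in_itv/= => /andP[x0 x1].
  rewrite -subr_ge0.
  have dWU (y : R) : y \in `]0, 1[ -> is_derive y 1 (W - U t) (u0 y + e - u t y).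
    by move=> y01; have dWy := dW _ y01; have dUy := dU _ _ t0 y01; apply: is_deriveB.
  have WU0 : (W - U t) 0 = 0 by rewrite !fctE W0 U0// subr0.
  rewrite -[leRHS]/((W - U t) x) -WU0.
  apply: (ger0_derive1_ndecr (b := 1)) => //.
  - by move=> y /dWU[].
  - move=> y y01; have [_ ydWU] := dWU _ y01.
    rewrite derive1E ydWU subr_ge0 -(cs_init sol y01); exact/ut/oo_cc.
  - by apply: within_continuousB => //; exact: cont_slice.
rewrite -RintegralZl//; last exact: within_continuous_integrable.
apply: le_Rintegral => //.
- by apply: within_continuous_integrable; apply: within_continuousXn; exact: cont_slice.
- apply: within_continuous_integrable; apply: within_continuousM => //.
  exact: within_continuous_cst.
- move=> x /= x01; have := UW _ x01.
  move: x01; rewrite in_itv/= => /andP[x0 x1] UWx.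
  have Ux0 : 0 <= U t x by rewrite -(U0 _ t0) U_mono.
  have UxM : U t x <= M by rewrite -(U1 _ t0) U_mono.
  rewrite exprSr; apply: ler_pM => //; first exact: exprn_ge0.
  by rewrite lerXn2r// nnegrE// ltW.
Qed.

Lemma global_solution_initial_moment (C d e : R) (W : R -> R) :
  0 < C -> 0 < d -> 2 * C * d = M ^+ 4 / 48 ->
  (forall r : R, 0 < r -> 0 <= - r * A r <= M ^+ 2 / 48 * r + C) ->
  0 < e -> {within `[0, 1], continuous W} -> W 0 = 0 ->
  (forall x : R, x \in `]0, 1[ -> is_derive x 1 W (u0 x + e)) ->
  M ^+ 4 / 8 / (M + 6 * C / d ^+ 2) <= M ^+ 2 * \int[mu]_(x in `[0, 1]) W x.
Proof.
move=> C0 d0 Cd AB e0 cW W0 dW.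
have [t t0] := initial_moment_bound _ _ e0 cW W0 dW.
exact: le_trans (moment_lower_bound _ _ _ C0 d0 Cd AB t0).
Qed.

End solution.

(** * Choice of concentrated initial data and the contradiction *)

Theorem theorem12 (R : realType) (a A B : R -> R)
    (a_C1 : C1_pos a)
    (a_pos : forall r : R, 0 < r -> 0 < a r)
    (a_L1 : (@lebesgue_measure R).-integrable `]1, +oo[ (EFin \o a))
    (A_def : forall r : R, 0 < r ->
       A r = - \int[@lebesgue_measure R]_(s in `]r, +oo[) a s)
    (B_concave : convex_function (`]0, +oo[%classic : set R) (\- B))
    (A_le_B : forall r : R, 0 < r -> 0 <= - r * A r <= B r)
    (B_sublinear : B r / r @[r --> +oo] --> 0)
    (M : R) (M_pos : 0 < M) :
  exists (u0 : R -> R) (m0 : R),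
    [/\ {within `[0, 1], continuous u0},
        0 < m0 < M,
        forall x : R, x \in `[0, 1] -> m0 <= u0 x,
        mean `[0, 1] u0 = M
      & forall (Tmax : \bar R) (u v : R -> R -> R),
          maximal_classical_solution a A M m0 u0 Tmax u v -> (Tmax < +oo)%E].
Proof.
have dA (r : R) : 0 < r -> is_derive r 1 A (a r).
  by move=> r0; apply: is_derive_tail_integral => //; case: a_C1.
have B0 (r : R) : 0 < r -> 0 <= B r.
  by move=> /A_le_B/andP[]; exact: le_trans.
have e0 : 0 < M ^+ 2 / 48 by rewrite divr_gt0// exprn_gt0.
have [C C0 BC] := concave_sublinear_affine_bound _ _ B_concave B0 B_sublinear e0.
have AB (r : R) : 0 < r -> 0 <= - r * A r <= M ^+ 2 / 48 * r + C.
  by move=> r0; have /andP[-> /le_trans ->//] := A_le_B _ r0; exact: BC.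
pose d := M ^+ 4 / (96 * C).
have d0 : 0 < d by rewrite divr_gt0 ?mulr_gt0 ?exprn_gt0.
have Cd : 2 * C * d = M ^+ 4 / 48 by rewrite /d; field; rewrite gt_eqF.
pose K := M + 6 * C / d ^+ 2.
have K0 : 0 < K.
  by apply: addr_gt0 => //; apply: divr_gt0; [exact: mulr_gt0|exact: exprn_gt0].
(* The lower bound on the moment reads [2 * s * M ^+ 2]: it suffices that the integral of [W] is a
   sum of two terms, one at most [s] and the other below [s]. *)
pose s := M ^+ 4 / 8 / K / (2 * M ^+ 2).
have s0 : 0 < s by rewrite /s !divr_gt0 ?mulr_gt0 ?exprn_gt0//.
pose m := Num.min (M / 2) s.
have m0 : 0 < m by rewrite lt_min s0 divr_gt0.
have mM : m < M by rewrite gt_min; apply/orP; left; lra.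
have ms : m <= s by rewrite ge_min lexx orbT.
pose n := Num.Def.archi_bound (M / s).
have nM : M / s < n%:R by apply: archi_boundP; rewrite divr_ge0// ltW.
(* The factor [n.+1%:R] normalises the power to mean 1, so the total mean is [m + (M - m) = M]. *)
pose u0 x := m + (M - m) * n.+1%:R * x ^+ n.
(* [V m] is the primitive of [u0]; [V (m + m)] that of [u0 + e] for [e = m]. *)
pose V c x := c * x + (M - m) * x ^+ n.+1.
have dV (c x : R) : is_derive x 1 (V c) (c + (M - m) * n.+1%:R * x ^+ n).
  have -> : V c = c \*: (id : R -> R) + (M - m) \*: (id : R -> R) ^+ n.+1.
    by apply/funext => y; rewrite !fctE.
  by apply: is_derive_eq; rewrite /GRing.scale/= !mulr1 mulrA.
have cV (c : R) : {within `[0, 1], continuous (V c)}.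
  apply: continuous_subspaceT => x; apply/differentiable_continuous.
  by rewrite -derivable1_diffP; have [] := dV c x.
have cu0 : {within `[0, 1], continuous u0}.
  apply: within_continuousD; first exact: within_continuous_cst.
  apply: within_continuousM; first exact: within_continuous_cst.
  by apply: within_continuousXn; apply: continuous_subspaceT => x; exact: cvg_id.
exists u0, m; split => //.
- by rewrite m0.
- move=> x; rewrite in_itv/= => /andP[x0 _].
  by rewrite lerDl !mulr_ge0// ?exprn_ge0// subr_ge0 ltW.
- rewrite /mean lebesgue_measure_itv/= lte_fin ltr01/= subr0 invr1 mul1r.
  rewrite (_ : \int[_]_(x in _) _ = V m 1 - V m 0); last by apply: Rintegral_FTC.
  by rewrite /V expr0n expr1n /=; ring.
- move=> Tmax u v [T0 sol _ _]; rewrite ltey; apply/eqP => Too.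
  rewrite Too in sol.
  have mM' : 0 < m < M by rewrite m0.
  have := @global_solution_initial_moment _ a A M m u0 u v a_C1.1 dA mM' sol C d m (V (m + m))
    C0 d0 Cd AB m0 (cV _).
  have V0 : V (m + m) 0 = 0 by rewrite /V expr0n !mulr0 addr0.
  move=> /(_ V0).
  have dV' (x : R) : x \in `]0, 1[ -> is_derive x 1 (V (m + m)) (u0 x + m).
    by move=> _; have := dV (m + m) x; rewrite /u0 [m + _ + m]addrAC.
  move=> /(_ dV'); apply/negP; rewrite -ltNge.
  (* A primitive of [V (m + m)]; hence the integral of [W] is [m + (M - m) / n.+2%:R], which is less
     than [2 * s]. *)
  pose G x := m * x ^+ 2 + (M - m) / n.+2%:R * x ^+ n.+2.
  have dG (x : R) : x \in `]0, 1[ -> is_derive x 1 G (V (m + m) x).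
    move=> _.
    have -> : G = m \*: (id : R -> R) ^+ 2 + ((M - m) / n.+2%:R) \*: (id : R -> R) ^+ n.+2.
      by apply/funext => y; rewrite !fctE.
    apply: is_derive_eq; rewrite /GRing.scale/= /V !mulr1; field.
    by rewrite -natrD pnatr_eq0.
  have cG : {within `[0, 1], continuous G}.
    apply: within_continuousD; apply: within_continuousM; try exact: within_continuous_cst;
      by apply: within_continuousXn; apply: continuous_subspaceT => x; exact: cvg_id.
  rewrite (Rintegral_FTC _ _ _ _ ltr01 cG (cV _) dG).
  rewrite /G !expr0n !expr1n /= !mulr0 addr0 subr0 !mulr1.
  have : (M - m) / n.+2%:R < s.
    rewrite ltr_pdivrMr ?ltr0n//.
    move: nM; rewrite ltr_pdivrMr// => nM.
    rewrite mulrC -[n.+2]addn2 natrD mulrDl.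
    have := mulr_gt0 (ltr0n R 2) s0; lra.
  move=> h; rewrite -/K.
  have -> : M ^+ 4 / 8 / K = M ^+ 2 * (2 * s).
    by rewrite /s; field; rewrite !gt_eqF.
  rewrite ltr_pM2l ?exprn_gt0//. by rewrite mulr_natl mulr2n ler_ltD.
Qed.
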